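(* Let $\mathcal P$ be a PRO, let $\mathcal M,\mathcal N$ be $\mathcal C$-actegories, let $(\mathbf S_\bullet,l^S):\mathcal P\to\mathrm{End}_{\mathcal C}(\mathcal M)$ and $(\mathbf T_\bullet,l^T):\mathcal P\to\mathrm{End}_{\mathcal C}(\mathcal N)$ be strict representations, and let $(K,\zeta^K,\alpha):(\mathbf T_\bullet,l^T)\to(\mathbf S_\bullet,l^S)$ be a map of pairs. Let $\tau:n\to p$ be a morphism of $\mathcal P$ with $n\ge1$, and $\tau^S:=\mathbf S_\bullet(\tau):S^n\Rightarrow S^p$. Then for every object $C$ of $\mathcal C$, writing $G^{\mathcal M}=C\lozenge^{\mathcal M}\_$, $G^{\mathcal N}=C\lozenge^{\mathcal N}\_$ and $\zeta=\zeta^K:KG^{\mathcal M}\Rightarrow G^{\mathcal N}K$, the following equality of natural transformations $TKS^{n-1}G^{\mathcal M}\Rightarrow G^{\mathcal N}KS^p$ holds: $$G^{\mathcal N}(K\tau^S\circ\alpha S^{n-1})\circ l^TKS^{n-1}\circ T\zeta S^{n-1}\circ TKl^{S(n-1)}=\zeta S^p\circ Kl^{S(p)}\circ(K\tau^S\circ\alpha S^{n-1})G^{\mathcal M},$$ where for $q\ge0$, $l^{S(q)}:S^qG^{\mathcal M}\Rightarrow G^{\mathcal M}S^q$ denotes $l^{S(q)}=l^SS^{q-1}\circ Sl^SS^{q-2}\circ\cdots\circ S^{q-1}l^S$ (the identity for $q=0$).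
   Context: A PRO is a strict monoidal category whose objects are the natural numbers (including $0$), with tensor product on objects the addition and unit object $0$. A strict representation of $\mathcal P$ in a strict monoidal category $\mathcal E$ is a strict monoidal functor $\mathcal P\to\mathcal E$. $\mathcal C$ is a fixed monoidal category with product $\otimes$, unit $\mathbf 1$, associativity isomorphisms $a_{X,Y,Z}:X\otimes(Y\otimes Z)\to(X\otimes Y)\otimes Z$ and unit isomorphisms $l_A:\mathbf 1\otimes A\to A$, $r_A:A\otimes\mathbf 1\to A$. A $\mathcal C$-actegory is a category $\mathcal N$ with a bifunctor $\lozenge:\mathcal C\times\mathcal N\to\mathcal N$ and natural isomorphisms $\Psi_{Q,Q',N}:(Q\otimes Q')\lozenge N\to Q\lozenge(Q'\lozenge N)$, $u_N:\mathbf 1\lozenge N\to N$ such that $\Psi_{Q,Q',Q''\lozenge N}\circ\Psi_{Q\otimes Q',Q'',N}\circ(a_{Q,Q',Q''}\lozenge N)=(Q\lozenge\Psi_{Q',Q'',N})\circ\Psi_{Q,Q'\otimes Q'',N}$, $u_{Q\lozenge N}\circ\Psi_{\mathbf 1,Q,N}=l_Q\lozenge N$, $(Q\lozenge u_N)\circ\Psi_{Q,\mathbf 1,N}=r_Q\lozenge N$. A colax $\mathcal C$-equivariant functor $(F,\zeta):\mathcal M\to\mathcal N$ is a functor $F$ with a binatural transformation $\zeta_{C,M}:F(C\lozenge M)\to C\lozenge F(M)$ with $u_{F(M)}\circ\zeta_{\mathbf 1,M}=F(u_M)$ and $\Psi_{A,B,F(M)}\circ\zeta_{A\otimes B,M}=(A\lozenge\zeta_{B,M})\circ\zeta_{A,B\lozenge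 M}\circ F(\Psi_{A,B,M})$. A natural transformation $\alpha:F\Rightarrow G$ is $\mathcal C$-equivariant $(F,\zeta^F)\Rightarrow(G,\zeta^G)$ if $(C\lozenge\alpha_M)\circ\zeta^F_{C,M}=\zeta^G_{C,M}\circ\alpha_{C\lozenge M}$. $\mathrm{End}_{\mathcal C}(\mathcal M)$ is the strict monoidal category of colax $\mathcal C$-equivariant endofunctors of $\mathcal M$ and equivariant natural transformations, with tensor product $(F,\zeta^F)\circ(G,\zeta^G)=(FG,\zeta^{FG})$, $\zeta^{FG}_{C,M}=\zeta^F_{C,GM}\circ F(\zeta^G_{C,M})$. A representation $\mathcal P\to\mathrm{End}_{\mathcal C}(\mathcal M)$ is written $(\mathbf S_\bullet,l^S)$: $\mathbf S_\bullet$ is the underlying representation in endofunctors, $S=\mathbf S_\bullet(1)$, $\mathbf S_\bullet(n)=S^n$, and $l^S_{C,M}:S(C\lozenge M)\to C\lozenge SM$ is the coherence of the image $(S,l^S)$ of $1$; for fixed $C$ it is a natural transformation $SG^{\mathcal M}\Rightarrow G^{\mathcal M}S$. A (colax) map of pairs $(K,\zeta^K,\alpha):(\mathbf T_\bullet,l^T)\to(\mathbf S_\bullet,l^S)$, with $\mathbf S_\bullet$ on $\mathcal M$ and $\mathbf T_\bullet$ on $\mathcal N$, is a colax $\mathcal C$-equivariant functor $(K,\zeta^K):\mathcal M\to\mathcal N$ with a natural transformation $\alpha:TK\Rightarrow KS$ such that $G^{\mathcal N}\alpha\circ l^TK\circ T\zeta^K=\zeta^KS\circ Kl^S\circ\alpha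 G^{\mathcal M}$ for all $C$, and for every $\tau:n\to p$ in $\mathcal P$, $K\tau^S\circ\alpha^{(n)}=\alpha^{(p)}\circ\tau^TK$, where $\tau^T=\mathbf T_\bullet(\tau)$, $\tau^S=\mathbf S_\bullet(\tau)$ and $\alpha^{(n)}=\alpha S^{n-1}\circ T\alpha S^{n-2}\circ\cdots\circ T^{n-1}\alpha:T^nK\Rightarrow KS^n$ (identity for $n=0$). *)

(* Defs.v *)
(* Plain Rocq with the Stdlib axioms of functional extensionality and proof
   irrelevance.  Categories have Leibniz equality on morphisms. *)
From Stdlib Require Import FunctionalExtensionality ProofIrrelevance.

Set Implicit Arguments.
Unset Strict Implicit.
Unset Printing Implicit Defensive.

Declare Scope cat_scope.
Delimit Scope cat_scope with cat.
Open Scope cat_scope.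

Reserved Notation "g \o f" (at level 40, left associativity).
Reserved Notation "F ** G" (at level 40, left associativity).
Reserved Notation "b \v a" (at level 55, left associativity).
Reserved Notation "F <| a" (at level 42, right associativity).
Reserved Notation "a |> F" (at level 41, left associativity).

(* The structure of a category on a given type of objects; it is separated
   from [Category] so that one can speak of categories with object type [nat]. *)
Record CatStr (Ob : Type) := MkCatStr {
  hom : Ob -> Ob -> Type;
  idm : forall A, hom A A;
  cmp : forall A B C, hom B C -> hom A B -> hom A C;
  cmp_idl : forall A B (f : hom A B), cmp (idm B) f = f;
  cmp_idr : forall A B (f : hom A B), cmp f (idm A) = f;
  cmp_assoc : forall A B C D (h : hom C D) (g : hom B C) (f : hom A B),
    cmp h (cmp g f) = cmp (cmp h g) f
}.

Record Category := MkCategory {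
  obj :> Type;
  cat_str : CatStr obj
}.

Definition Hom (C : Category) : C -> C -> Type := hom (cat_str C).
Definition Id (C : Category) (A : C) : Hom A A := idm (cat_str C) A.
Definition comp (C : Category) (A B D : C) (g : Hom B D) (f : Hom A B) : Hom A D :=
  cmp (c := cat_str C) g f.
Notation "g \o f" := (comp g f) : cat_scope.

Lemma comp_idl (C : Category) (A B : C) (f : Hom A B) : Id B \o f = f.
Proof. exact (cmp_idl f). Qed.
Lemma comp_idr (C : Category) (A B : C) (f : Hom A B) : f \o Id A = f.
Proof. exact (cmp_idr f). Qed.
Lemma comp_assoc (C : Category) (A B D E : C)
  (h : Hom D E) (g : Hom B D) (f : Hom A B) : h \o (g \o f) = (h \o g) \o f.
Proof. exact (cmp_assoc h g f). Qed.

Definition is_iso (C : Category) (A B : C) (f : Hom A B) : Prop :=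
  exists g : Hom B A, g \o f = Id A /\ f \o g = Id B.

(* The identity morphism, viewed along an equality of objects. *)
Definition eq_hom (C : Category) (A B : C) (e : A = B) : Hom A B :=
  match e in _ = B' return Hom A B' with eq_refl => Id A end.

Lemma eq_hom_id (C : Category) (A : C) (e : A = A) : eq_hom e = Id A.
Proof. now rewrite (proof_irrelevance _ e eq_refl). Qed.

(* Because [FunctorData] has primitive projections, composition of functor data
   is associative and unital up to conversion; natural transformations only
   mention the data, so that no coercion is needed between, e.g., natural
   transformations out of [(F ** G) ** H] and out of [F ** (G ** H)]. *)
Set Primitive Projections.
Record FunctorData (A B : Category) := MkFunctorData {
  fobj :> A -> B;
  fmap : forall X Y : A, Hom X Y -> Hom (fobj X) (fobj Y)
}.
Unset Primitive Projections.

Record Functor (A B : Category) := MkFunctor {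
  fdata :> FunctorData A B;
  fmap_id : forall X : A, fmap fdata (Id X) = Id (fdata X);
  fmap_comp : forall (X Y Z : A) (g : Hom Y Z) (f : Hom X Y),
    fmap fdata (g \o f) = fmap fdata g \o fmap fdata f
}.

Lemma functor_eq (A B : Category) (F G : Functor A B) : fdata F = fdata G -> F = G.
Proof.
destruct F as [D i c], G as [D' i' c']; simpl; intros e; destruct e.
f_equal; apply proof_irrelevance.
Qed.

Definition fdid (A : Category) : FunctorData A A :=
  MkFunctorData (fun (X Y : A) (f : Hom X Y) => f).

Definition fid (A : Category) : Functor A A :=
  @MkFunctor A A (fdid A) (fun X => eq_refl) (fun X Y Z g f => eq_refl).

Definition fdcomp (A B C : Category) (F : FunctorData B C) (G : FunctorData A B) :
    FunctorData A C :=
  MkFunctorData (fun (X Y : A) (f : Hom X Y) => fmap F (fmap G f)).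

Lemma fcomp_id (A B C : Category) (F : Functor B C) (G : Functor A B) (X : A) :
  fmap (fdcomp F G) (Id X) = Id (fdcomp F G X).
Proof. simpl. now rewrite !fmap_id. Qed.

Lemma fcomp_comp (A B C : Category) (F : Functor B C) (G : Functor A B) (X Y Z : A)
  (g : Hom Y Z) (f : Hom X Y) :
  fmap (fdcomp F G) (g \o f) = fmap (fdcomp F G) g \o fmap (fdcomp F G) f.
Proof. simpl. now rewrite !fmap_comp. Qed.

Definition fcomp (A B C : Category) (F : Functor B C) (G : Functor A B) : Functor A C :=
  @MkFunctor A C (fdcomp F G) (@fcomp_id A B C F G) (@fcomp_comp A B C F G).
Notation "F ** G" := (fcomp F G) : cat_scope.

(* [fpow F n] is F^n, with F^(n+1) = F F^n. *)
Fixpoint fpow (A : Category) (F : Functor A A) (n : nat) : Functor A A :=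
  match n with
  | O => fid A
  | S n' => F ** fpow F n'
  end.

Record NatTrans (A B : Category) (F G : FunctorData A B) := MkNatTrans {
  nt :> forall X : A, Hom (F X) (G X);
  nt_nat : forall (X Y : A) (f : Hom X Y), fmap G f \o nt X = nt Y \o fmap F f
}.

Lemma nt_eq (A B : Category) (F G : FunctorData A B) (a b : NatTrans F G) :
  (forall X, a X = b X) -> a = b.
Proof.
destruct a as [a na], b as [b nb]; simpl; intros e.
assert (e' : a = b) by (apply functional_extensionality_dep; exact e).
destruct e'; f_equal; apply proof_irrelevance.
Qed.

Lemma nt_id_nat (A B : Category) (F : FunctorData A B) (X Y : A) (f : Hom X Y) :
  fmap F f \o Id (F X) = Id (F Y) \o fmap F f.
Proof. now rewrite comp_idl, comp_idr. Qed.

Definition nt_id (A B : Category) (F : FunctorData A B) : NatTrans F F :=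
  MkNatTrans (@nt_id_nat A B F).

Lemma vcomp_nat (A B : Category) (F G H : FunctorData A B)
  (b : NatTrans G H) (a : NatTrans F G) (X Y : A) (f : Hom X Y) :
  fmap H f \o (b X \o a X) = (b Y \o a Y) \o fmap F f.
Proof. now rewrite comp_assoc, nt_nat, <- comp_assoc, nt_nat, comp_assoc. Qed.

Definition vcomp (A B : Category) (F G H : FunctorData A B)
    (b : NatTrans G H) (a : NatTrans F G) : NatTrans F H :=
  @MkNatTrans A B F H (fun X => b X \o a X) (vcomp_nat b a).
Notation "b \v a" := (vcomp b a) : cat_scope.

(* Whiskering: [K <| a] has components K(a_X), and [a |> K] has components a_(K X). *)
Lemma whiskl_nat (A B C : Category) (K : Functor B C) (F G : FunctorData A B)
  (a : NatTrans F G) (X Y : A) (f : Hom X Y) :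
  fmap (fdcomp K G) f \o fmap K (a X) = fmap K (a Y) \o fmap (fdcomp K F) f.
Proof. simpl. now rewrite <- !fmap_comp, nt_nat. Qed.

Definition whiskl (A B C : Category) (K : Functor B C) (F G : FunctorData A B)
    (a : NatTrans F G) : NatTrans (fdcomp K F) (fdcomp K G) :=
  @MkNatTrans A C (fdcomp K F) (fdcomp K G) (fun X => fmap K (a X)) (whiskl_nat K a).
Notation "K <| a" := (whiskl K a) : cat_scope.

Definition whiskr (A B C : Category) (F G : FunctorData B C) (a : NatTrans F G)
    (K : FunctorData A B) : NatTrans (fdcomp F K) (fdcomp G K) :=
  @MkNatTrans A C (fdcomp F K) (fdcomp G K) (fun X => a (K X))
    (fun X Y f => nt_nat a (fmap K f)).
Notation "a |> K" := (whiskr a K) : cat_scope.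

(* The identity natural transformation, viewed along an equality of functors. *)
Definition eq_nt (A B : Category) (F G : Functor A B) (e : F = G) : NatTrans F G :=
  match e in _ = G' return NatTrans F G' with eq_refl => nt_id F end.

(* A functor A x B -> C. *)
Record Bifunctor (A B C : Category) := MkBifunctor {
  bobj :> A -> B -> C;
  bmap : forall (X X' : A) (Y Y' : B), Hom X X' -> Hom Y Y' -> Hom (bobj X Y) (bobj X' Y');
  bmap_id : forall (X : A) (Y : B), bmap (Id X) (Id Y) = Id (bobj X Y);
  bmap_comp : forall (X X' X'' : A) (Y Y' Y'' : B)
    (f' : Hom X' X'') (f : Hom X X') (g' : Hom Y' Y'') (g : Hom Y Y'),
    bmap (f' \o f) (g' \o g) = bmap f' g' \o bmap f g
}.

Record MonoidalCategory := MkMonoidalCategory {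
  mon_cat :> Category;
  tens : Bifunctor mon_cat mon_cat mon_cat;
  one : mon_cat;
  assoc : forall X Y Z : mon_cat, Hom (tens X (tens Y Z)) (tens (tens X Y) Z);
  lunit : forall A : mon_cat, Hom (tens one A) A;
  runit : forall A : mon_cat, Hom (tens A one) A;
  assoc_iso : forall X Y Z, is_iso (assoc X Y Z);
  lunit_iso : forall A, is_iso (lunit A);
  runit_iso : forall A, is_iso (runit A);
  assoc_nat : forall (X X' Y Y' Z Z' : mon_cat) (f : Hom X X') (g : Hom Y Y') (h : Hom Z Z'),
    bmap tens (bmap tens f g) h \o assoc X Y Z =
    assoc X' Y' Z' \o bmap tens f (bmap tens g h);
  lunit_nat : forall (A A' : mon_cat) (f : Hom A A'),
    f \o lunit A = lunit A' \o bmap tens (Id one) f;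
  runit_nat : forall (A A' : mon_cat) (f : Hom A A'),
    f \o runit A = runit A' \o bmap tens f (Id one);
  pentagon : forall W X Y Z : mon_cat,
    assoc (tens W X) Y Z \o assoc W X (tens Y Z) =
    bmap tens (assoc W X Y) (Id Z) \o assoc W (tens X Y) Z
      \o bmap tens (Id W) (assoc X Y Z);
  triangle : forall X Y : mon_cat,
    bmap tens (runit X) (Id Y) \o assoc X one Y = bmap tens (Id X) (lunit Y)
}.

Record Actegory (C : MonoidalCategory) := MkActegory {
  act_cat :> Category;
  act : Bifunctor C act_cat act_cat;
  act_psi : forall (Q Q' : C) (N : act_cat),
    Hom (act (tens C Q Q') N) (act Q (act Q' N));
  act_u : forall N : act_cat, Hom (act (one C) N) N;
  act_psi_iso : forall Q Q' N, is_iso (act_psi Q Q' N);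
  act_u_iso : forall N, is_iso (act_u N);
  act_psi_nat : forall (Q1 Q2 Q1' Q2' : C) (N1 N2 : act_cat)
    (f : Hom Q1 Q2) (f' : Hom Q1' Q2') (g : Hom N1 N2),
    bmap act f (bmap act f' g) \o act_psi Q1 Q1' N1 =
    act_psi Q2 Q2' N2 \o bmap act (bmap (tens C) f f') g;
  act_u_nat : forall (N N' : act_cat) (g : Hom N N'),
    g \o act_u N = act_u N' \o bmap act (Id (one C)) g;
  act_assoc : forall (Q Q' Q'' : C) (N : act_cat),
    act_psi Q Q' (act Q'' N) \o act_psi (tens C Q Q') Q'' N
      \o bmap act (assoc Q Q' Q'') (Id N) =
    bmap act (Id Q) (act_psi Q' Q'' N) \o act_psi Q (tens C Q' Q'') N;
  act_lunit : forall (Q : C) (N : act_cat),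
    act_u (act Q N) \o act_psi (one C) Q N = bmap act (lunit Q) (Id N);
  act_runit : forall (Q : C) (N : act_cat),
    bmap act (Id Q) (act_u N) \o act_psi Q (one C) N = bmap act (runit Q) (Id N)
}.

Definition actd (C : MonoidalCategory) (N : Actegory C) (Q : C) : FunctorData N N :=
  MkFunctorData (fun (X Y : N) (g : Hom X Y) => bmap (act N) (Id Q) g).

Lemma actd_id (C : MonoidalCategory) (N : Actegory C) (Q : C) (X : N) :
  fmap (actd N Q) (Id X) = Id (actd N Q X).
Proof. exact (bmap_id (act N) Q X). Qed.

Lemma actd_comp (C : MonoidalCategory) (N : Actegory C) (Q : C) (X Y Z : N)
  (g : Hom Y Z) (f : Hom X Y) :
  fmap (actd N Q) (g \o f) = fmap (actd N Q) g \o fmap (actd N Q) f.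
Proof. simpl. now rewrite <- bmap_comp, comp_idl. Qed.

(* The endofunctor of N acting with a fixed object Q, usually written G. *)
Definition actF (C : MonoidalCategory) (N : Actegory C) (Q : C) : Functor N N :=
  @MkFunctor N N (actd N Q) (@actd_id C N Q) (@actd_comp C N Q).

Record ColaxFunctor (C : MonoidalCategory) (M N : Actegory C) := MkColaxFunctor {
  cx_fun :> Functor M N;
  cx_zeta : forall (Q : C) (X : M), Hom (cx_fun (act M Q X)) (act N Q (cx_fun X));
  cx_nat : forall (Q Q' : C) (X X' : M) (f : Hom Q Q') (g : Hom X X'),
    bmap (act N) f (fmap cx_fun g) \o cx_zeta Q X =
    cx_zeta Q' X' \o fmap cx_fun (bmap (act M) f g);
  cx_unit : forall X : M,
    act_u (cx_fun X) \o cx_zeta (one C) X = fmap cx_fun (act_u X);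
  cx_mult : forall (A B : C) (X : M),
    act_psi A B (cx_fun X) \o cx_zeta (tens C A B) X =
    bmap (act N) (Id A) (cx_zeta B X) \o cx_zeta A (act M B X)
      \o fmap cx_fun (act_psi A B X)
}.

Lemma colax_eq (C : MonoidalCategory) (M N : Actegory C) (F G : ColaxFunctor M N)
  (e : fdata F = fdata G) :
  (forall (Q : C) (X : M),
     eq_hom (f_equal (fun D : FunctorData M N => act N Q (D X)) e) \o cx_zeta F Q X =
     cx_zeta G Q X \o eq_hom (f_equal (fun D : FunctorData M N => D (act M Q X)) e)) ->
  F = G.
Proof.
destruct F as [F z z1 z2 z3], G as [G z' z1' z2' z3']; simpl in *.
pose proof (functor_eq e) as e'; destruct e'.
rewrite (proof_irrelevance _ e eq_refl); simpl; intros ez.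
assert (e' : z = z').
{ apply functional_extensionality_dep; intros Q.
  apply functional_extensionality_dep; intros X.
  rewrite <- (comp_idl (z Q X)), <- (comp_idr (z' Q X)); apply ez. }
destruct e'; f_equal; apply proof_irrelevance.
Qed.

Lemma zetaF_nat (C : MonoidalCategory) (M N : Actegory C) (F : ColaxFunctor M N) (Q : C)
  (X Y : M) (f : Hom X Y) :
  fmap (fdcomp (actF N Q) F) f \o cx_zeta F Q X =
  cx_zeta F Q Y \o fmap (fdcomp F (actF M Q)) f.
Proof. exact (cx_nat F (Id Q) f). Qed.

(* For a fixed Q, the coherence as a natural transformation F G^M => G^N F. *)
Definition zetaF (C : MonoidalCategory) (M N : Actegory C) (F : ColaxFunctor M N) (Q : C) :
    NatTrans (F ** actF M Q) (actF N Q ** F) :=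
  @MkNatTrans M N (fdcomp F (actF M Q)) (fdcomp (actF N Q) F)
    (cx_zeta F Q) (@zetaF_nat C M N F Q).

Record EqvTrans (C : MonoidalCategory) (M N : Actegory C) (F G : ColaxFunctor M N) :=
  MkEqvTrans {
  et_nt :> NatTrans F G;
  et_eqv : forall (Q : C) (X : M),
    bmap (act N) (Id Q) (et_nt X) \o cx_zeta F Q X =
    cx_zeta G Q X \o et_nt (act M Q X)
}.

Lemma et_eq (C : MonoidalCategory) (M N : Actegory C) (F G : ColaxFunctor M N)
  (a b : EqvTrans F G) : (forall X, a X = b X) -> a = b.
Proof.
destruct a as [a ea], b as [b eb]; simpl; intros e.
pose proof (nt_eq e) as e'; destruct e'; f_equal; apply proof_irrelevance.
Qed.

(* A strict monoidal structure on [E] with given tensor product and unit on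
   objects.  Both sides of the associativity and unit laws for morphisms are
   compared along the corresponding equalities of objects. *)
Record StrictMonStr (E : Category) (ten : E -> E -> E) (un : E) := MkStrictMonStr {
  st_mor : forall A A' B B' : E, Hom A A' -> Hom B B' -> Hom (ten A B) (ten A' B');
  st_id : forall A B : E, st_mor (Id A) (Id B) = Id (ten A B);
  st_comp : forall (A A' A'' B B' B'' : E)
    (f' : Hom A' A'') (f : Hom A A') (g' : Hom B' B'') (g : Hom B B'),
    st_mor (f' \o f) (g' \o g) = st_mor f' g' \o st_mor f g;
  st_assoc : forall A B D : E, ten A (ten B D) = ten (ten A B) D;
  st_lunit : forall A : E, ten un A = A;
  st_runit : forall A : E, ten A un = A;
  st_assoc_mor : forall (A A' B B' D D' : E) (f : Hom A A') (g : Hom B B') (h : Hom D D'),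
    eq_hom (st_assoc A' B' D') \o st_mor f (st_mor g h) =
    st_mor (st_mor f g) h \o eq_hom (st_assoc A B D);
  st_lunit_mor : forall (A A' : E) (f : Hom A A'),
    eq_hom (st_lunit A') \o st_mor (Id un) f = f \o eq_hom (st_lunit A);
  st_runit_mor : forall (A A' : E) (f : Hom A A'),
    eq_hom (st_runit A') \o st_mor f (Id un) = f \o eq_hom (st_runit A)
}.

Record StrictMonoidal := MkStrictMonoidal {
  sm_cat :> Category;
  sm_ten : sm_cat -> sm_cat -> sm_cat;
  sm_un : sm_cat;
  sm_str : StrictMonStr sm_ten sm_un
}.

Record StrictMonFunctor (D E : StrictMonoidal) := MkStrictMonFunctor {
  sf_fun :> Functor D E;
  sf_ten : forall A B : D, sf_fun (sm_ten A B) = sm_ten (sf_fun A) (sf_fun B);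
  sf_un : sf_fun (sm_un D) = sm_un E;
  sf_mor : forall (A A' B B' : D) (f : Hom A A') (g : Hom B B'),
    eq_hom (sf_ten A' B') \o fmap sf_fun (st_mor (sm_str D) f g) =
    st_mor (sm_str E) (fmap sf_fun f) (fmap sf_fun g) \o eq_hom (sf_ten A B)
}.

Record PRO := MkPRO {
  pro_cat : CatStr nat;
  pro_str : @StrictMonStr (MkCategory pro_cat) Nat.add 0
}.

Coercion pro_sm (P : PRO) : StrictMonoidal := MkStrictMonoidal (pro_str P).

Lemma et_id_eqv (C : MonoidalCategory) (M N : Actegory C) (F : ColaxFunctor M N)
  (Q : C) (X : M) :
  bmap (act N) (Id Q) (nt_id F X) \o cx_zeta F Q X =
  cx_zeta F Q X \o nt_id F (act M Q X).
Proof. simpl. now rewrite bmap_id, comp_idl, comp_idr. Qed.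

Definition et_id (C : MonoidalCategory) (M N : Actegory C) (F : ColaxFunctor M N) :
    EqvTrans F F :=
  @MkEqvTrans C M N F F (nt_id F) (et_id_eqv F).

Lemma et_comp_eqv (C : MonoidalCategory) (M N : Actegory C) (F G H : ColaxFunctor M N)
  (b : EqvTrans G H) (a : EqvTrans F G) (Q : C) (X : M) :
  bmap (act N) (Id Q) ((b \v a) X) \o cx_zeta F Q X =
  cx_zeta H Q X \o (b \v a) (act M Q X).
Proof.
simpl. rewrite <- (comp_idl (Id Q)), bmap_comp, <- comp_assoc, et_eqv, comp_assoc.
now rewrite et_eqv, comp_assoc.
Qed.

Definition et_comp (C : MonoidalCategory) (M N : Actegory C) (F G H : ColaxFunctor M N)
    (b : EqvTrans G H) (a : EqvTrans F G) : EqvTrans F H :=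
  @MkEqvTrans C M N F H (b \v a) (et_comp_eqv b a).

Definition endc_str (C : MonoidalCategory) (M : Actegory C) : CatStr (ColaxFunctor M M).
Proof.
refine (@MkCatStr (ColaxFunctor M M) (fun F G => EqvTrans F G) (fun F => et_id F)
  (fun F G H b a => et_comp b a) _ _ _).
- intros; apply et_eq; intros X; apply comp_idl.
- intros; apply et_eq; intros X; apply comp_idr.
- intros; apply et_eq; intros X; apply comp_assoc.
Defined.

Definition EndCat (C : MonoidalCategory) (M : Actegory C) : Category :=
  MkCategory (endc_str M).

Definition colax_id (C : MonoidalCategory) (M : Actegory C) : ColaxFunctor M M.
Proof.
refine (@MkColaxFunctor C M M (fid M) (fun Q X => Id (act M Q X)) _ _ _).
- intros; simpl. now rewrite comp_idl, comp_idr.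
- intros; simpl. now rewrite comp_idr.
- intros; simpl. now rewrite bmap_id, comp_idr, !comp_idl.
Defined.

Definition colax_comp (C : MonoidalCategory) (M : Actegory C) (F G : ColaxFunctor M M) :
    ColaxFunctor M M.
Proof.
refine (@MkColaxFunctor C M M (F ** G)
  (fun Q X => cx_zeta F Q (G X) \o fmap F (cx_zeta G Q X)) _ _ _).
- intros; simpl.
  now rewrite comp_assoc, cx_nat, <- !comp_assoc, <- !fmap_comp, cx_nat.
- intros; simpl. now rewrite comp_assoc, cx_unit, <- fmap_comp, cx_unit.
- intros A B X; simpl.
  rewrite comp_assoc, cx_mult, <- !comp_assoc, <- fmap_comp, cx_mult.
  rewrite <- (comp_idl (Id A)), bmap_comp, !fmap_comp, <- !comp_assoc, !comp_idl.
  f_equal. rewrite !comp_assoc. f_equal. f_equal. symmetry.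
  exact (cx_nat F (Id A) (cx_zeta G B X)).
Defined.

(* Horizontal composition of a : F => F' and b : G => G', with components
   F'(b_X) a_(G X) : F G X -> F' G' X. *)
Definition hcomp (A B D : Category) (F F' : Functor B D) (G G' : Functor A B)
    (a : NatTrans F F') (b : NatTrans G G') : NatTrans (F ** G) (F' ** G') :=
  (F' <| b) \v (a |> G).

Lemma et_ten_eqv (C : MonoidalCategory) (M : Actegory C) (F F' G G' : ColaxFunctor M M)
  (a : EqvTrans F F') (b : EqvTrans G G') (Q : C) (X : M) :
  bmap (act M) (Id Q) (hcomp a b X) \o cx_zeta (colax_comp F G) Q X =
  cx_zeta (colax_comp F' G') Q X \o hcomp a b (act M Q X).
Proof.
simpl.
rewrite <- (comp_idl (Id Q)), bmap_comp, <- !comp_assoc.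
rewrite (comp_assoc _ _ (fmap F (cx_zeta G Q X))), et_eqv, <- comp_assoc.
rewrite <- nt_nat, !comp_assoc. f_equal.
rewrite (cx_nat F' (Id Q) (b X)), <- !comp_assoc, <- !fmap_comp.
now rewrite et_eqv.
Qed.

Definition et_ten (C : MonoidalCategory) (M : Actegory C) (F F' G G' : ColaxFunctor M M)
    (a : EqvTrans F F') (b : EqvTrans G G') :
    EqvTrans (colax_comp F G) (colax_comp F' G') :=
  @MkEqvTrans C M M (colax_comp F G) (colax_comp F' G') (hcomp a b) (et_ten_eqv a b).

Lemma colax_assoc (C : MonoidalCategory) (M : Actegory C) (F G H : ColaxFunctor M M) :
  colax_comp F (colax_comp G H) = colax_comp (colax_comp F G) H.
Proof.
apply (@colax_eq C M M (colax_comp F (colax_comp G H)) (colax_comp (colax_comp F G) H)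
  eq_refl).
intros Q X; simpl. now rewrite comp_idl, comp_idr, fmap_comp, comp_assoc.
Qed.

Lemma colax_lunit (C : MonoidalCategory) (M : Actegory C) (F : ColaxFunctor M M) :
  colax_comp (colax_id M) F = F.
Proof.
apply (@colax_eq C M M (colax_comp (colax_id M) F) F eq_refl).
intros Q X; simpl. now rewrite !comp_idl, comp_idr.
Qed.

Lemma colax_runit (C : MonoidalCategory) (M : Actegory C) (F : ColaxFunctor M M) :
  colax_comp F (colax_id M) = F.
Proof.
apply (@colax_eq C M M (colax_comp F (colax_id M)) F eq_refl).
intros Q X; simpl. now rewrite !comp_idl, fmap_id.
Qed.

Lemma eq_hom_square (C : MonoidalCategory) (M : Actegory C)
  (F F' G G' : ColaxFunctor M M) (e : F = G) (e' : F' = G')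
  (a : EqvTrans F F') (b : EqvTrans G G') (X : M) :
  forall (d : fobj F X = fobj G X) (d' : fobj F' X = fobj G' X),
  eq_hom d' \o a X = b X \o eq_hom d ->
  nt (et_nt (@comp (EndCat M) F F' G' (@eq_hom (EndCat M) F' G' e') a)) X =
  nt (et_nt (@comp (EndCat M) F G G' b (@eq_hom (EndCat M) F G e))) X.
Proof.
destruct e, e'; intros d d'; rewrite !eq_hom_id.
now intros ed; simpl; rewrite ed.
Qed.

Definition endc_mon (C : MonoidalCategory) (M : Actegory C) :
  @StrictMonStr (EndCat M) (fun F G => colax_comp F G) (colax_id M).
Proof.
refine (@MkStrictMonStr (EndCat M) (fun F G => colax_comp F G) (colax_id M)
  (fun F F' G G' a b => et_ten a b) _ _
  (fun F G H => colax_assoc F G H) (fun F => colax_lunit F) (fun F => colax_runit F) _ _ _).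
- intros F G; apply et_eq; intros X; simpl. now rewrite fmap_id, comp_idl.
- intros F F' F'' G G' G'' f' f g' g; apply et_eq; intros X; simpl.
  rewrite fmap_comp, <- !comp_assoc. f_equal. rewrite !comp_assoc. f_equal.
  now rewrite nt_nat.
- intros F F' G G' H H' f g h; apply et_eq; intros X.
  refine (@eq_hom_square C M _ _ _ _ (colax_assoc F G H) (colax_assoc F' G' H')
    _ _ X eq_refl eq_refl _); simpl; rewrite comp_idl, comp_idr. now rewrite fmap_comp, comp_assoc.
- intros F F' f; apply et_eq; intros X.
  refine (@eq_hom_square C M _ _ _ _ (colax_lunit F) (colax_lunit F')
    _ _ X eq_refl eq_refl _); simpl. now rewrite !comp_idl, !comp_idr.
- intros F F' f; apply et_eq; intros X.
  refine (@eq_hom_square C M _ _ _ _ (colax_runit F) (colax_runit F')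
    _ _ X eq_refl eq_refl _); simpl; rewrite comp_idl, comp_idr. now rewrite fmap_id, comp_idl.
Defined.

Definition EndC (C : MonoidalCategory) (M : Actegory C) : StrictMonoidal :=
  MkStrictMonoidal (endc_mon M).

Definition Rep (P : PRO) (C : MonoidalCategory) (M : Actegory C) : Type :=
  StrictMonFunctor P (EndC M).

(* The pair (S, l^S); [cx_fun (rep_gen R)] is S and [zetaF (rep_gen R) Q] is l^S at Q. *)
Definition rep_gen (P : PRO) (C : MonoidalCategory) (M : Actegory C) (R : Rep P M) :
    ColaxFunctor M M := R 1.

Definition rep_obj (P : PRO) (C : MonoidalCategory) (M : Actegory C) (R : Rep P M)
    (n : nat) : Functor M M := cx_fun (R n).

Lemma rep_pow (P : PRO) (C : MonoidalCategory) (M : Actegory C) (R : Rep P M) (n : nat) :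
  rep_obj R n = fpow (rep_gen R) n.
Proof.
induction n as [|n IH]; unfold rep_obj in *.
- exact (f_equal (@cx_fun C M M) (sf_un R)).
- simpl. rewrite <- IH.
  exact (f_equal (@cx_fun C M M) (sf_ten R 1 n)).
Qed.

(* tau^S : S^n => S^p.  The image of tau goes from the image of n to the image of
   p, which are equal, but not convertible, to S^n and S^p. *)
Definition rep_mor (P : PRO) (C : MonoidalCategory) (M : Actegory C) (R : Rep P M)
    (n p : nat) (tau : @Hom P n p) :
    NatTrans (fpow (rep_gen R) n) (fpow (rep_gen R) p) :=
  eq_nt (rep_pow R p) \v et_nt (fmap R tau) \v eq_nt (eq_sym (rep_pow R n)).

(* [lpow F Q q] is l^(q) = l F^(q-1) o F l F^(q-2) o ... o F^(q-1) l : F^q G => G F^q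
   for the coherence l = zeta^F_Q of F, where G is the action of Q. *)
Fixpoint lpow (C : MonoidalCategory) (M : Actegory C) (F : ColaxFunctor M M) (Q : C)
    (q : nat) : NatTrans (fpow F q ** actF M Q) (actF M Q ** fpow F q) :=
  match q with
  | O => nt_id (actF M Q)
  | S q' => (zetaF F Q |> fpow F q') \v (F <| lpow F Q q')
  end.

(* [alpha_pow a n] is
   a^(n) = a F^(n-1) o T a F^(n-2) o ... o T^(n-1) a : T^n K => K F^n. *)
Fixpoint alpha_pow (M N : Category) (T : Functor N N) (K : Functor M N) (F : Functor M M)
    (a : NatTrans (T ** K) (K ** F)) (n : nat) :
    NatTrans (fpow T n ** K) (K ** fpow F n) :=
  match n with
  | O => nt_id K
  | S n' => (a |> fpow F n') \v (T <| alpha_pow a n')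
  end.

Record PairMap (P : PRO) (C : MonoidalCategory) (M N : Actegory C)
    (RT : Rep P N) (RS : Rep P M) := MkPairMap {
  pm_fun :> ColaxFunctor M N;
  pm_alpha : NatTrans (rep_gen RT ** pm_fun) (pm_fun ** rep_gen RS);
  pm_eqv : forall Q : C,
    (actF N Q <| pm_alpha) \v (zetaF (rep_gen RT) Q |> pm_fun)
      \v (rep_gen RT <| zetaF pm_fun Q) =
    (zetaF pm_fun Q |> rep_gen RS) \v (pm_fun <| zetaF (rep_gen RS) Q)
      \v (pm_alpha |> actF M Q);
  pm_rep : forall (n p : nat) (tau : @Hom P n p),
    (pm_fun <| rep_mor RS tau) \v alpha_pow pm_alpha n =
    alpha_pow pm_alpha p \v (rep_mor RT tau |> pm_fun)
}.

(* Main.v *)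
From Stdlib Require Import ProofIrrelevance.
Require Import Defs.

(** Since the representation S takes values in equivariant endofunctors, the
    transformation tau^S is equivariant, and strict monoidality forces the
    coherence of S^q to be the iterate l^(q) of the coherence l of the generator
    ([rep_coherence]).  Hence tau^S commutes with these iterates
    ([rep_mor_equivariant]): G tau^S o l^(n) = l^(p) o tau^S G.

    Componentwise, the theorem is then a pasting of four commuting diagrams
    ([paste_pair_map]).  The pair map
    condition, taken at S^(n-1) X, turns G alpha o l^T o T zeta into
    zeta o K l^S o alpha.  Naturality of alpha moves T K l^(n-1) across alpha as
    K S l^(n-1), which together with K l^S forms K l^(n).  Naturality of zeta
    moves G K tau^S across zeta, and equivariance of tau^S, under K, exchanges
    l^(n) for l^(p). *)

(** A strict representation sends n to a functor that is only propositionally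
    equal to the n-th power of the generator, so its coherence can be compared
    with [lpow] only along an equality of functors e. *)
Definition coherence_is {C : MonoidalCategory} {M : Actegory C} {Q : C}
    {G : ColaxFunctor M M} {H : Functor M M} (e : cx_fun G = H)
    (l : NatTrans (H ** actF M Q) (actF M Q ** H)) : Prop :=
  forall X : M,
    fmap (actF M Q) (eq_nt e X) \o cx_zeta G Q X = l X \o eq_nt e (actF M Q X).

(** The equality e' is arbitrary, so that the induction in [rep_coherence] never
    has to compute the equality that strict monoidality provides; once e is
    the identity, so is e', by proof irrelevance. *)
Lemma coherence_is_comp {C : MonoidalCategory} {M : Actegory C} {Q : C}
  (F : ColaxFunctor M M) {G : ColaxFunctor M M} {H : Functor M M} (e : cx_fun G = H)
  (l : NatTrans (H ** actF M Q) (actF M Q ** H))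
  (e' : cx_fun (colax_comp F G) = F ** H) :
  coherence_is e l ->
  coherence_is e' ((zetaF F Q |> H) \v (F <| l)).
Proof.
destruct e; intros hl X.
rewrite (proof_irrelevance _ e' eq_refl); specialize (hl X); simpl in *.
rewrite bmap_id, comp_idl, comp_idr in hl.
now rewrite bmap_id, comp_idl, comp_idr, hl.
Qed.

Lemma coherence_is_id {C : MonoidalCategory} {M : Actegory C} {Q : C}
  (e : cx_fun (colax_id M) = fid M) :
  coherence_is e (nt_id (actF M Q)).
Proof.
intros X; rewrite (proof_irrelevance _ e eq_refl); simpl.
now rewrite bmap_id.
Qed.

(** Induction on n: n + 1 is the tensor product of 1 and n, so strictness makes
    the value at n + 1 the composite of the generator with the value at n, and
    the coherence of a composite satisfies the recursion that defines [lpow]. *)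
Lemma rep_coherence {P : PRO} {C : MonoidalCategory} {M : Actegory C}
  (R : Rep P M) (Q : C) (n : nat) (e : cx_fun (R n) = fpow (rep_gen R) n) :
  coherence_is e (lpow (rep_gen R) Q n).
Proof.
revert e; induction n as [|n IH].
- pose proof (sf_un R : R 0 = colax_id M) as h; rewrite h.
  exact coherence_is_id.
- pose proof (sf_ten R 1 n : R (S n) = colax_comp (rep_gen R) (R n)) as h.
  rewrite h; intros e'.
  exact (coherence_is_comp _ (rep_pow R n) _ e' (IH _)).
Qed.

(** Removing both identifications turns the equation into the equivariance of a. *)
Lemma coherence_is_equivariant {C : MonoidalCategory} {M : Actegory C} {Q : C}
  {F G : ColaxFunctor M M} (a : EqvTrans F G)
  {H H' : Functor M M} (e : cx_fun F = H) (e' : cx_fun G = H')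
  (l : NatTrans (H ** actF M Q) (actF M Q ** H))
  (l' : NatTrans (H' ** actF M Q) (actF M Q ** H')) :
  coherence_is e l -> coherence_is e' l' ->
  let b := eq_nt e' \v et_nt a \v eq_nt (eq_sym e) in
  (actF M Q <| b) \v l = l' \v (b |> actF M Q).
Proof.
destruct e, e'; intros hl hl'; apply nt_eq; intros X.
specialize (hl X); specialize (hl' X); simpl in *.
rewrite bmap_id, comp_idl, comp_idr in hl, hl'.
rewrite !comp_idl, !comp_idr, <- hl, <- hl'.
apply et_eqv.
Qed.

Lemma rep_mor_equivariant {P : PRO} {C : MonoidalCategory} {M : Actegory C}
  (R : Rep P M) {n p : nat} (tau : @Hom P n p) (Q : C) :
  (actF M Q <| rep_mor R tau) \v lpow (rep_gen R) Q n =
  lpow (rep_gen R) Q p \v (rep_mor R tau |> actF M Q).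
Proof.
exact (coherence_is_equivariant (fmap R tau) _ _ _ _
  (rep_coherence R Q n (rep_pow R n)) (rep_coherence R Q p (rep_pow R p))).
Qed.

(** The pasting at one object, with plain families of morphisms in place of the
    natural transformations, so that every object has a single syntactic form.
    In the application V = S^(n-1) X, V' = S^(n-1) G X, W = S^p X, W' = S^p G X. *)
Lemma paste_pair_map {A B : Category} (S1 GM : Functor A A) (T1 GN : Functor B B)
  (K : Functor A B)
  (alpha : forall X : A, Hom (T1 (K X)) (K (S1 X)))
  (zeta : forall X : A, Hom (K (GM X)) (GN (K X)))
  (lS : forall X : A, Hom (S1 (GM X)) (GM (S1 X)))
  (lT : forall Y : B, Hom (T1 (GN Y)) (GN (T1 Y)))
  (V V' W W' : A) (t : Hom (S1 V) W) (t' : Hom (S1 V') W')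
  (lV : Hom V' (GM V)) (lW : Hom W' (GM W)) :
  fmap GN (alpha V) \o lT (K V) \o fmap T1 (zeta V)
    = zeta (S1 V) \o fmap K (lS V) \o alpha (GM V) ->
  fmap GM t \o (lS V \o fmap S1 lV) = lW \o t' ->
  fmap K (fmap S1 lV) \o alpha V' = alpha (GM V) \o fmap T1 (fmap K lV) ->
  fmap GN (fmap K t) \o zeta (S1 V) = zeta W \o fmap K (fmap GM t) ->
  fmap GN (fmap K t \o alpha V) \o lT (K V) \o fmap T1 (zeta V)
      \o fmap T1 (fmap K lV)
    = zeta W \o fmap K lW \o (fmap K t' \o alpha V').
Proof.
intros pair_at t_eqv alpha_nat zeta_nat.
transitivity (fmap GN (fmap K t)
  \o ((fmap GN (alpha V) \o lT (K V) \o fmap T1 (zeta V))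
      \o fmap T1 (fmap K lV))).
{ now rewrite fmap_comp, !comp_assoc. }
rewrite pair_at, <- !comp_assoc, <- alpha_nat.
rewrite comp_assoc, zeta_nat, <- !comp_assoc; f_equal.
now rewrite !comp_assoc, <- !fmap_comp, <- t_eqv, comp_assoc.
Qed.

Theorem mainTheorem4 (P : PRO) (C : MonoidalCategory) (M N : Actegory C)
  (RS : Rep P M) (RT : Rep P N) (K : PairMap RT RS)
  (m p : nat) (tau : @Hom P (S m) p) (Q : C) :
  let GM := actF M Q in
  let GN := actF N Q in
  let S1 := rep_gen RS in
  let T1 := rep_gen RT in
  let alpha := pm_alpha K in
  let tauS := rep_mor RS tau in
  (GN <| ((K <| tauS) \v (alpha |> fpow S1 m)))
    \v (zetaF T1 Q |> K ** fpow S1 m)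
    \v (T1 <| zetaF K Q |> fpow S1 m)
    \v (T1 ** K <| lpow S1 Q m)
  = (zetaF K Q |> fpow S1 p)
    \v (K <| lpow S1 Q p)
    \v (((K <| tauS) \v (alpha |> fpow S1 m)) |> GM)
  :> NatTrans (T1 ** K ** fpow S1 m ** GM) (GN ** K ** fpow S1 p).
Proof.
intros GM GN S1 T1 alpha tauS; apply nt_eq; intros X.
exact (paste_pair_map S1 GM T1 GN K (nt alpha)
  (cx_zeta K Q) (cx_zeta S1 Q) (cx_zeta T1 Q)
  (fpow S1 m X) (fpow S1 m (GM X)) (fpow S1 p X) (fpow S1 p (GM X))
  (tauS X) (tauS (GM X)) (lpow S1 Q m X) (lpow S1 Q p X)
  (f_equal (fun f => nt f (fpow S1 m X)) (pm_eqv K Q))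
  (f_equal (fun f => nt f X) (rep_mor_equivariant RS tau Q))
  (nt_nat alpha (lpow S1 Q m X))
  (zetaF_nat K Q (tauS X))).
Qed.
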